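(* Let $\mathcal{C}$ be a multifusion category over $\Bbbk$. Then $\mathrm{Gr}(\mathcal{C})$ is a fusion ring if and only if the functor $-\otimes A:\mathcal{C}\to\mathcal{C}_A$ is separable for any non-zero algebra $A$ in $\mathcal{C}$.
   Context: $\Bbbk$ is an algebraically closed field. A multitensor category over $\Bbbk$ is a locally finite (finite-dimensional Hom spaces, all objects of finite length) $\Bbbk$-linear abelian rigid monoidal category with bilinear tensor product; a multifusion category is a finite (finitely many isomorphism classes of simple objects, enough projectives) semisimple multitensor category. $\mathrm{Gr}(\mathcal{C})$ is the Grothendieck ring: the free abelian group on isomorphism classes of simple objects of $\mathcal{C}$, with multiplication induced by $\otimes$ and unit $[1]$; it is a $\mathbb{Z}_+$-ring with basis the classes of simple objects. A $\mathbb{Z}_+$-ring is a ring, free as a $\mathbb{Z}$-module, with a fixed basis $\{b_i\}_{i\in I}$ such that $b_ib_j=\sum_k c_{ij}^k b_k$ with $c_{ij}^k\in\mathbb{Z}_{\ge 0}$, and with unit $1$ a non-negative linear combination of basis elements; it is unital if $1$ is a basis element. Let $I_0$ be the set of $i\in I$ such that $b_i$ occurs in the decomposition of $1$, and let $\tau$ be the group homomorphism to $\mathbb{Z}$ with $\tau(b_i)=1$ if $i\in I_0$ and $\tau(b_i)=0$ if $i\notin I_0$. A $\mathbb{Z}_+$-ring is a based ring if there is an involution $i\mapsto i^*$ of $I$ such that the induced map $\sum a_ib_i\mapsto\sum a_ib_{i^*}$ is an anti-involution of the ring and $\tau(b_ib_j)=1$ if $i=j^*$, $\tau(b_ib_j)=0$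 if $i\neq j^*$. A fusion ring is a unital based ring of finite rank. For an algebra $A$ in $\mathcal{C}$, $\mathcal{C}_A$ is the category of right $A$-modules in $\mathcal{C}$ and $-\otimes A:\mathcal{C}\to\mathcal{C}_A$ is $M\mapsto(M\otimes A,M\otimes m_A)$, $f\mapsto f\otimes A$. A functor $F:\mathcal{C}\to\mathcal{D}$ is separable if there is a natural transformation $\mathcal{P}:\mathrm{Hom}_{\mathcal{D}}(F-,F-)\to\mathrm{Hom}_{\mathcal{C}}(-,-)$ with $\mathcal{P}(F(f))=f$ for every morphism $f$ in $\mathcal{C}$.
   Formalization: The multifusion category is assumed non-zero (its unit object is not a zero object); for the zero category the right side is vacuously true, while its Grothendieck ring is 0 with empty basis and so is not unital. *)

(* Defs.v *)
From HB Require Import structures.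
From mathcomp Require Import all_boot all_order all_algebra.
From mathcomp Require Import boolp classical_sets.
From mathcomp.multinomials Require Import freeg.

Set Implicit Arguments.
Unset Strict Implicit.
Unset Printing Implicit Defensive.

Import GRing.Theory Num.Theory.
Local Open Scope ring_scope.

(** * Categories, functors, separability *)

Record category := Category {
  cat_ob :> Type;
  cat_hom : cat_ob -> cat_ob -> Type;
  cat_id : forall X, cat_hom X X;
  cat_comp : forall X Y Z, cat_hom Y Z -> cat_hom X Y -> cat_hom X Z;
  cat_compA : forall W X Y Z
    (h : cat_hom Y Z) (g : cat_hom X Y) (f : cat_hom W X),
    cat_comp h (cat_comp g f) = cat_comp (cat_comp h g) f;
  cat_comp1f : forall X Y (f : cat_hom X Y), cat_comp (cat_id Y) f = f;
  cat_compf1 : forall X Y (f : cat_hom X Y), cat_comp f (cat_id X) = f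
}.

Record functor (C D : category) := Functor {
  fun_ob :> C -> D;
  fun_map : forall X Y : C, cat_hom X Y -> cat_hom (fun_ob X) (fun_ob Y);
  fun_map1 : forall X, fun_map (cat_id X) = cat_id (fun_ob X);
  fun_mapM : forall (X Y Z : C) (g : cat_hom Y Z) (f : cat_hom X Y),
    fun_map (cat_comp g f) = cat_comp (fun_map g) (fun_map f)
}.

(** The second clause is naturality of [P] in both variables. *)
Definition separable (C D : category) (F : functor C D) : Prop :=
  exists P : forall X Y : C, cat_hom (F X) (F Y) -> cat_hom X Y,
    (forall (X Y : C) (f : cat_hom X Y), P X Y (fun_map F f) = f) /\
    (forall (X X' Y Y' : C) (f : cat_hom X' X) (g : cat_hom Y Y')
            (h : cat_hom (F X) (F Y)),
       P X' Y' (cat_comp (fun_map F g) (cat_comp h (fun_map F f))) =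
       cat_comp g (cat_comp (P X Y h) f)).

(** * Linear categories with finite-dimensional Hom spaces *)

Declare Scope cat_scope.
Delimit Scope cat_scope with cat.
Local Open Scope cat_scope.

(** A [vectType k] is a finite-dimensional vector space over [k]. *)
Record linCategory (k : fieldType) := LinCategory {
  Ob :> Type;
  Hom : Ob -> Ob -> vectType k;
  idm : forall X, Hom X X;
  comp : forall X Y Z, Hom Y Z -> Hom X Y -> Hom X Z;
  compA : forall W X Y Z (h : Hom Y Z) (g : Hom X Y) (f : Hom W X),
    comp h (comp g f) = comp (comp h g) f;
  comp1f : forall X Y (f : Hom X Y), comp (idm Y) f = f;
  compf1 : forall X Y (f : Hom X Y), comp f (idm X) = f;
  comp_linl : forall X Y Z (a : k) (g g' : Hom Y Z) (f : Hom X Y),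
    comp (a *: g + g') f = a *: comp g f + comp g' f;
  comp_linr : forall X Y Z (a : k) (g : Hom Y Z) (f f' : Hom X Y),
    comp g (a *: f + f') = a *: comp g f + comp g f'
}.

Arguments Hom {k l} : rename.
Arguments idm {k l} : rename.
Arguments comp {k l X Y Z} : rename.

Notation "g \o f" := (comp g f) : cat_scope.

Definition cat_of (k : fieldType) (C : linCategory k) : category :=
  @Category (Ob C) (@Hom k C) (@idm k C) (@comp k C)
    (@compA k C) (@comp1f k C) (@compf1 k C).
Coercion cat_of : linCategory >-> category.

Section LinearCategory.
Variables (k : fieldType) (C : linCategory k).
Implicit Types X Y Z S : Ob C.

Definition is_zero X : Prop :=
  forall Y, (forall f : Hom X Y, f = 0) /\ (forall f : Hom Y X, f = 0).

Definition is_mono X Y (f : Hom X Y) : Prop :=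
  forall W (g h : Hom W X), f \o g = f \o h -> g = h.

Definition is_epi X Y (f : Hom X Y) : Prop :=
  forall Z (g h : Hom Y Z), g \o f = h \o f -> g = h.

Definition is_inverse X Y (f : Hom X Y) (g : Hom Y X) : Prop :=
  g \o f = idm X /\ f \o g = idm Y.

Definition is_iso X Y (f : Hom X Y) : Prop := exists g, is_inverse f g.

Definition isomorphic X Y : Prop := exists f : Hom X Y, is_iso f.

Definition is_kernel X Y Z (f : Hom Y Z) (i : Hom X Y) : Prop :=
  f \o i = 0 /\
  forall W (g : Hom W Y), f \o g = 0 -> exists! h : Hom W X, i \o h = g.

Definition is_cokernel X Y Z (f : Hom X Y) (p : Hom Y Z) : Prop :=
  p \o f = 0 /\
  forall W (g : Hom Y W), g \o f = 0 -> exists! h : Hom Z W, h \o p = g.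

Definition is_direct_sum n (S : 'I_n -> Ob C) X : Prop :=
  exists (i : forall j, Hom (S j) X) (p : forall j, Hom X (S j)),
    [/\ forall j, p j \o i j = idm (S j),
        forall j l, j != l -> p l \o i j = 0
      & \sum_(j < n) (i j \o p j) = idm X].

(** The case [n = 0] of the first clause gives a zero object. *)
Definition is_abelian : Prop :=
  [/\ forall n (S : 'I_n -> Ob C), exists X, is_direct_sum S X,
      forall X Y (f : Hom X Y), exists W (i : Hom W X), is_kernel f i,
      forall X Y (f : Hom X Y), exists W (p : Hom Y W), is_cokernel f p,
      forall X Y (f : Hom X Y), is_mono f ->
        exists W (g : Hom Y W), is_kernel g f
    & forall X Y (f : Hom X Y), is_epi f ->
        exists W (g : Hom W X), is_cokernel g f].

Definition simple S : Prop :=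
  ~ is_zero S /\
  forall Y (f : Hom Y S), is_mono f -> is_zero Y \/ is_iso f.

Record simpleObj := SimpleObj { simple_ob :> Ob C; _ : simple simple_ob }.

HB.instance Definition _ := gen_eqMixin simpleObj.
HB.instance Definition _ := gen_choiceMixin simpleObj.

Definition short_exact X Y Z (f : Hom X Y) (g : Hom Y Z) : Prop :=
  is_kernel g f /\ is_cokernel f g.

(** [composition_series X s]: [X] has a Jordan-Hölder series whose successive
    simple quotients, from the top down, are the entries of [s]. *)
Inductive composition_series : Ob C -> seq simpleObj -> Prop :=
| CSnil X : is_zero X -> composition_series X [::]
| CScons Y X (S : simpleObj) s (f : Hom Y X) (g : Hom X S) :
    short_exact f g -> composition_series Y s -> composition_series X (S :: s).

Definition locally_finite : Prop :=
  forall X, exists s, composition_series X s.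

Definition semisimple : Prop :=
  forall X, exists n (S : 'I_n -> Ob C),
    (forall j, simple (S j)) /\ is_direct_sum S X.

Definition projective P : Prop :=
  forall X Y (e : Hom X Y) (f : Hom P Y), is_epi e ->
    exists h : Hom P X, e \o h = f.

Definition enough_projectives : Prop :=
  forall X, exists P (e : Hom P X), projective P /\ is_epi e.

Definition finitely_many_simples : Prop :=
  exists n (S : 'I_n -> Ob C), forall X, simple X -> exists j, isomorphic X (S j).

Definition is_finite : Prop := finitely_many_simples /\ enough_projectives.

End LinearCategory.

(** * Monoidal categories *)

Record monCategory (k : fieldType) := MonCategory {
  mon_lin :> linCategory k;
  tens : mon_lin -> mon_lin -> mon_lin;
  unit_ob : mon_lin;
  tensm : forall X X' Y Y' : mon_lin,
    Hom X X' -> Hom Y Y' -> Hom (tens X Y) (tens X' Y');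
  tensm1 : forall X Y, tensm (idm X) (idm Y) = idm (tens X Y);
  tensmM : forall (X X' X'' Y Y' Y'' : mon_lin)
    (f' : Hom X' X'') (f : Hom X X') (g' : Hom Y' Y'') (g : Hom Y Y'),
    tensm (f' \o f) (g' \o g) = tensm f' g' \o tensm f g;
  tensm_linl : forall (X X' Y Y' : mon_lin) (a : k)
    (f f' : Hom X X') (g : Hom Y Y'),
    tensm (a *: f + f') g = a *: tensm f g + tensm f' g;
  tensm_linr : forall (X X' Y Y' : mon_lin) (a : k)
    (f : Hom X X') (g g' : Hom Y Y'),
    tensm f (a *: g + g') = a *: tensm f g + tensm f g';
  assoc : forall X Y Z, Hom (tens (tens X Y) Z) (tens X (tens Y Z));
  assocV : forall X Y Z, Hom (tens X (tens Y Z)) (tens (tens X Y) Z);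
  assoc_inv : forall X Y Z, is_inverse (assoc X Y Z) (assocV X Y Z);
  assoc_nat : forall (X X' Y Y' Z Z' : mon_lin)
    (f : Hom X X') (g : Hom Y Y') (h : Hom Z Z'),
    assoc X' Y' Z' \o tensm (tensm f g) h =
    tensm f (tensm g h) \o assoc X Y Z;
  lunit : forall X, Hom (tens unit_ob X) X;
  lunitV : forall X, Hom X (tens unit_ob X);
  lunit_inv : forall X, is_inverse (lunit X) (lunitV X);
  lunit_nat : forall (X Y : mon_lin) (f : Hom X Y),
    lunit Y \o tensm (idm unit_ob) f = f \o lunit X;
  runit : forall X, Hom (tens X unit_ob) X;
  runitV : forall X, Hom X (tens X unit_ob);
  runit_inv : forall X, is_inverse (runit X) (runitV X);
  runit_nat : forall (X Y : mon_lin) (f : Hom X Y),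
    runit Y \o tensm f (idm unit_ob) = f \o runit X;
  pentagon : forall W X Y Z,
    assoc W X (tens Y Z) \o assoc (tens W X) Y Z =
    tensm (idm W) (assoc X Y Z) \o
      (assoc W (tens X Y) Z \o tensm (assoc W X Y) (idm Z));
  triangle : forall X Y,
    tensm (idm X) (lunit Y) \o assoc X unit_ob Y = tensm (runit X) (idm Y)
}.

Arguments tens {k m} : rename.
Arguments unit_ob {k} m : rename.
Arguments tensm {k m X X' Y Y'} : rename.
Arguments assoc {k m} : rename.
Arguments assocV {k m} : rename.
Arguments lunit {k m} : rename.
Arguments lunitV {k m} : rename.
Arguments runit {k m} : rename.
Arguments runitV {k m} : rename.

Notation "X \ox Y" := (tens X Y) (at level 40, left associativity) : cat_scope.
Notation "f \om g" := (tensm f g) (at level 40, left associativity) : cat_scope.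

Section Monoidal.
Variables (k : fieldType) (C : monCategory k).
Implicit Types X Y Z : C.

(** [Y] is a left dual of [X], equivalently [X] is a right dual of [Y]. *)
Definition is_left_dual X Y : Prop :=
  exists (ev : Hom (Y \ox X) (unit_ob C)) (coev : Hom (unit_ob C) (X \ox Y)),
    runit X \o (idm X \om ev) \o assoc X Y X \o (coev \om idm X) \o lunitV X
      = idm X /\
    lunit Y \o (ev \om idm Y) \o assocV Y X Y \o (idm Y \om coev) \o runitV Y
      = idm Y.

Definition rigid : Prop :=
  forall X, (exists Y, is_left_dual X Y) /\ (exists Y, is_left_dual Y X).

Definition multitensor : Prop := [/\ is_abelian C, locally_finite C & rigid].

Definition multifusion : Prop := [/\ multitensor, is_finite C & semisimple C].

(** Kelly's coherence lemma; it is what makes [X \ox A] satisfy the unit axiom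
    of a right [A]-module below. *)
Lemma tensm_unit_inj X Y (f g : Hom X Y) :
  f \om idm (unit_ob C) = g \om idm (unit_ob C) -> f = g.
Proof.
move=> e; have h (u : Hom X Y) : u = runit Y \o (u \om idm _) \o runitV X.
  by rewrite runit_nat -compA (runit_inv X).2 compf1.
by rewrite (h f) (h g) e.
Qed.

Lemma assoc_mono X Y Z : is_mono (assoc X Y Z).
Proof.
move=> W f g e; rewrite -[f]comp1f -[g]comp1f -(assoc_inv X Y Z).1.
by rewrite -!compA e.
Qed.

Lemma runit_tens X Y :
  (idm X \om runit Y) \o assoc X Y (unit_ob C) = runit (X \ox Y).
Proof.
apply: tensm_unit_inj; apply: (@assoc_mono X Y (unit_ob C)).
rewrite -[in RHS]triangle -tensm1 compA assoc_nat -compA pentagon compA.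
rewrite -tensmM comp1f triangle compA -assoc_nat -compA -tensmM.
by rewrite comp1f.
Qed.

(** ** Algebras, modules and the free module functor *)

Record algebra := Algebra {
  alg_ob :> C;
  alg_mul : Hom (alg_ob \ox alg_ob) alg_ob;
  alg_unit : Hom (unit_ob C) alg_ob;
  alg_mulA : alg_mul \o (alg_mul \om idm alg_ob) =
             alg_mul \o (idm alg_ob \om alg_mul) \o assoc alg_ob alg_ob alg_ob;
  alg_mul1l : alg_mul \o (alg_unit \om idm alg_ob) = lunit alg_ob;
  alg_mul1r : alg_mul \o (idm alg_ob \om alg_unit) = runit alg_ob
}.

Variable A : algebra.

Record rmodule := RModule {
  rmod_ob :> C;
  rmod_act : Hom (rmod_ob \ox A) rmod_ob;
  rmod_actA : rmod_act \o (rmod_act \om idm A) =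
              rmod_act \o (idm rmod_ob \om alg_mul A) \o assoc rmod_ob A A;
  rmod_act1 : rmod_act \o (idm rmod_ob \om alg_unit A) = runit rmod_ob
}.

Record rmod_hom (M N : rmodule) := RModHom {
  rmod_map :> Hom M N;
  rmod_mapP : rmod_map \o rmod_act M == rmod_act N \o (rmod_map \om idm A)
}.

Lemma rmod_map_inj M N : injective (@rmod_map M N).
Proof.
by move=> [f fP] [g gP] /= e; case: _ / e gP => gP; rewrite (bool_irrelevance fP gP).
Qed.

Lemma rmod_id_subproof (M : rmodule) :
  idm M \o rmod_act M == rmod_act M \o (idm M \om idm A).
Proof. by rewrite tensm1 comp1f compf1. Qed.

Definition rmod_id M : rmod_hom M M := RModHom (rmod_id_subproof M).

Lemma rmod_comp_subproof (M N P : rmodule) (g : rmod_hom N P)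
    (f : rmod_hom M N) :
  (g \o f) \o rmod_act M == rmod_act P \o ((g \o f) \om idm A).
Proof.
rewrite -[X in _ \om X](comp1f (idm A)) tensmM -compA (eqP (rmod_mapP f)).
by rewrite !compA (eqP (rmod_mapP g)).
Qed.

Definition rmod_comp M N P (g : rmod_hom N P) (f : rmod_hom M N) :
  rmod_hom M P := RModHom (rmod_comp_subproof g f).

Lemma rmod_compA M N P Q (h : rmod_hom P Q) (g : rmod_hom N P)
    (f : rmod_hom M N) :
  rmod_comp h (rmod_comp g f) = rmod_comp (rmod_comp h g) f.
Proof. by apply: rmod_map_inj; rewrite /= compA. Qed.

Lemma rmod_comp1f M N (f : rmod_hom M N) : rmod_comp (rmod_id N) f = f.
Proof. by apply: rmod_map_inj; rewrite /= comp1f. Qed.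

Lemma rmod_compf1 M N (f : rmod_hom M N) : rmod_comp f (rmod_id M) = f.
Proof. by apply: rmod_map_inj; rewrite /= compf1. Qed.

Definition rmod_category : category :=
  Category rmod_compA rmod_comp1f rmod_compf1.

Definition free_act X : Hom ((X \ox A) \ox A) (X \ox A) :=
  (idm X \om alg_mul A) \o assoc X A A.

Lemma free_actA X :
  free_act X \o (free_act X \om idm A) =
  free_act X \o (idm (X \ox A) \om alg_mul A) \o assoc (X \ox A) A A.
Proof.
have idA (Y Z W : C) (g : Hom Z W) (f : Hom Y Z) :
    (g \o f) \om idm A = (g \om idm A) \o (f \om idm A).
  by rewrite -tensmM comp1f.
have idX (Y Z W : C) (g : Hom Z W) (f : Hom Y Z) :
    idm X \om (g \o f) = (idm X \om g) \o (idm X \om f).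
  by rewrite -tensmM comp1f.
rewrite /free_act idA compA -[X in X \o _]compA assoc_nat.
rewrite [in LHS]compA -idX alg_mulA !idX -[in RHS]tensm1.
rewrite -[X in _ = X \o _]compA assoc_nat -!compA pentagon.
by [].
Qed.

Lemma free_act1 X :
  free_act X \o (idm (X \ox A) \om alg_unit A) = runit (X \ox A).
Proof.
rewrite /free_act -tensm1 -compA assoc_nat compA -tensmM comp1f alg_mul1r.
exact: runit_tens.
Qed.

Definition free_rmodule X : rmodule := RModule (free_actA X) (free_act1 X).

Lemma free_map_subproof X Y (f : Hom X Y) :
  (f \om idm A) \o free_act X == free_act Y \o ((f \om idm A) \om idm A).
Proof.
by rewrite /free_act -compA assoc_nat !compA -!tensmM tensm1 !comp1f !compf1.
Qed.

Definition free_map X Y (f : Hom X Y) :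
  rmod_hom (free_rmodule X) (free_rmodule Y) :=
  @RModHom (free_rmodule X) (free_rmodule Y) _ (free_map_subproof f).

Lemma free_map1 X : free_map (idm X) = rmod_id (free_rmodule X).
Proof. by apply: rmod_map_inj; rewrite /= tensm1. Qed.

Lemma free_mapM X Y Z (g : Hom Y Z) (f : Hom X Y) :
  free_map (g \o f) = rmod_comp (free_map g) (free_map f).
Proof. by apply: rmod_map_inj; rewrite /= -tensmM comp1f. Qed.

Definition free_functor : functor C rmod_category :=
  @Functor C rmod_category free_rmodule free_map free_map1 free_mapM.

End Monoidal.

(** * Based rings and fusion rings *)

(** A multiplication and a unit on the free abelian group [{freeg I}], whose
    fixed basis [<< i >>] is indexed by [I]. No axiom is included here. *)
Record basedData := BasedData {
  bd_index : choiceType;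
  bd_mul : {freeg bd_index} -> {freeg bd_index} -> {freeg bd_index};
  bd_one : {freeg bd_index}
}.

Section BasedRings.
Variable R : basedData.
Local Notation I := (bd_index R).
Local Notation mul := (@bd_mul R).
Local Notation one := (@bd_one R).

Definition bd_basis (i : I) : {freeg I} := << i >>.
Local Notation b := bd_basis.

(** [{freeg I}] is an abelian group, so these are the remaining ring axioms. *)
Definition is_ring : Prop :=
  [/\ associative mul, left_id one mul, right_id one mul,
      left_distributive mul +%R & right_distributive mul +%R].

Definition is_Zplus_ring : Prop :=
  [/\ is_ring,
      forall i j l : I, 0 <= coeff l (mul (b i) (b j))
    & forall l : I, 0 <= coeff l one].

Definition is_unital : Prop := exists i : I, one = b i.

(** [coeff i one != 0] says that [i] belongs to the set I_0 of indices of the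
    basis elements occurring in the unit. *)
Definition tau : {freeg I} -> int :=
  fglift (fun i : I => (coeff i one != 0)%:R : int^o).

Definition is_based_ring : Prop :=
  is_Zplus_ring /\
  exists star : I -> I,
    let starR : {freeg I} -> {freeg I} := fglift (fun i => b (star i)) in
    [/\ involutive star,
        forall x y, starR (mul x y) = mul (starR y) (starR x)
      & forall i j : I, tau (mul (b i) (b j)) = (i == star j)%:R].

Definition is_fusion_ring : Prop :=
  [/\ is_based_ring, is_unital & exists s : seq I, forall i : I, i \in s].

End BasedRings.

(** * The Grothendieck ring *)

Section Grothendieck.
Variables (k : fieldType) (C : monCategory k).

Definition iso_rel : rel (simpleObj C) := fun S T => `[< isomorphic S T >].

Lemma iso_rel_refl : reflexive iso_rel.
Proof.
by move=> S; apply/asboolP; exists (idm _), (idm _); split; rewrite comp1f.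
Qed.

Lemma iso_rel_sym : symmetric iso_rel.
Proof.
move=> S T; apply/asboolP/asboolP => -[f [g [gf fg]]];
  by exists g, f; split.
Qed.

Lemma iso_rel_trans : transitive iso_rel.
Proof.
move=> T S U /asboolP[f [f' [ff1 ff2]]] /asboolP[g [g' [gg1 gg2]]].
apply/asboolP; exists (g \o f), (f' \o g'); split.
  by rewrite -compA [g' \o _]compA gg1 comp1f.
by rewrite -compA [f \o _]compA ff2 comp1f.
Qed.

Canonical iso_equiv_rel := EquivRel iso_rel iso_rel_refl iso_rel_sym iso_rel_trans.

Definition simple_class := {eq_quot iso_rel}%qT.
HB.instance Definition _ := Choice.on simple_class.
HB.instance Definition _ : EqQuotient _ iso_rel simple_class :=
  EqQuotient.on simple_class.

(** The class of [X] is the sum of the classes of the simple quotients of a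
    chosen Jordan-Hölder series of [X] (independent of the choice by the
    Jordan-Hölder theorem). *)
Definition gr_class (X : C) : {freeg simple_class} :=
  \sum_(S <- xget [::] [set s | composition_series X s]%classic)
     << (\pi_simple_class S)%qT >>.

(** The biadditive extension of [[S]] * [[T]] := [[S \ox T]]; [repr] picks a
    simple object in an isomorphism class. *)
Definition gr_mul (x y : {freeg simple_class}) : {freeg simple_class} :=
  fglift (fun i : simple_class =>
    fglift (fun j : simple_class => gr_class (repr i \ox repr j)) y) x.

Definition Gr : basedData := BasedData gr_mul (gr_class (unit_ob C)).

End Grothendieck.

(* Main.v *)
From HB Require Import structures.
From mathcomp Require Import all_boot all_order all_algebra.
From mathcomp Require Import boolp classical_sets.
From mathcomp.multinomials Require Import freeg.
Require Import Defs.

Set Implicit Arguments.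
Unset Strict Implicit.
Unset Printing Implicit Defensive.

Import GRing.Theory Num.Theory.
Local Open Scope ring_scope.
Local Open Scope cat_scope.

(** Everything is governed by the unit object: both sides of the equivalence say
    that it is simple.

    If the unit is simple and [A] is a non-zero algebra, then the unit morphism
    of [A] is non-zero, hence split by semisimplicity, and inserting the unit of
    [A] on the source and a retraction of it on the target turns a morphism of
    free modules back into a morphism of [C], naturally
    ([unit_retract_separable]). A separable functor is faithful. If the unit is
    a direct sum of [Y] and a simple object [S], then [S] inherits from the unit
    an algebra structure, and the idempotent onto [Y] is killed by tensoring
    with [S]; faithfulness makes this idempotent zero, so the unit is [S]
    ([separable_unit_simple]).

    On the other side, the class of an object is a basis element only if the
    object is simple ([gr_class_basis_simple]), which handles a unital
    Grothendieck ring. It remains to see that the Grothendieck ring is a fusion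
    ring once the unit is simple. By Schur's lemma, the coefficient of the class
    of a simple object [S] in the class of [X] is the dimension of the space of
    morphisms from [S] to [X] ([coeff_gr_class]), so that identities between
    classes become identities between dimensions of Hom spaces. The ring axioms
    follow from the coherence isomorphisms and from
    [gr_mul_class : [X][Y] = [X \ox Y]]. The involution is given by left duals:
    the two adjunctions attached to a dual pair ([hdim_left_dual] and
    [hdim_right_dual]), together with the symmetry of Hom dimensions when one
    side is simple, show that left duality is an involution on classes,
    reverses products, and detects the unit in a product of two simple
    objects. *)

(** * Linear algebra *)

Lemma dim_inj_le (k : fieldType) (U V : vectType k) (f : U -> V) :
  linear f -> injective f -> (dim U <= dim V)%N.
Proof.
move=> lin_f inj_f.
pose F : {linear U -> V} := HB.pack f (GRing.isLinear.Build k U V _ f lin_f).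
have kerF : lker (linfun F) == 0%VS.
  by apply/lker0P => u v; rewrite !lfunE; apply: inj_f.
have := limg_dim_eq (f := linfun F) (U := fullv).
by rewrite (eqP kerF) capv0 dimvf => /(_ erefl) <-; rewrite -dimvf dimvS ?subvf.
Qed.

Lemma dim_eq0 (k : fieldType) (U : vectType k) :
  (forall u : U, u = 0) <-> dim U = 0%N.
Proof.
rewrite -dimvf; split=> [U0|/eqP]; last first.
  by rewrite dimv_eq0 => /eqP U0 u; apply/eqP; rewrite -memv0 -U0 memvf.
by apply/eqP; rewrite dimv_eq0 -subv0; apply/subvP => u _; rewrite (U0 u) mem0v.
Qed.

Section Eigenvector.
Import VectorInternalTheory.

Lemma closed_eigenvector (k : closedFieldType) (U : vectType k) (f : U -> U) :
  linear f -> (0 < dim U)%N -> exists a v, v != 0 /\ f v = a *: v.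
Proof.
move=> lin_f U_gt0.
pose g (x : 'rV[k]_(dim U)) := v2r (f (r2v x)).
have lin_g : linear g by move=> a x y; rewrite /g linearP lin_f linearP.
pose G : {linear 'rV[k]_(dim U) -> 'rV[k]_(dim U)} :=
  HB.pack g (GRing.isLinear.Build k _ _ _ g lin_g).
have /closed_rootP[a] : size (char_poly (lin1_mx G)) != 1%N.
  by rewrite size_char_poly; case: (dim U) U_gt0.
rewrite -eigenvalue_root_char => /eigenvalueP[v vE v_neq0].
exists a, (r2v v); split.
  by apply: contra_neq v_neq0 => /(congr1 v2r); rewrite r2vK linear0.
have Gv : v2r (f (r2v v)) = a *: v by rewrite -vE mul_rV_lin1.
by rewrite -[LHS]v2rK Gv linearZ.
Qed.

End Eigenvector.

(** * Hom spaces and Schur's lemma *)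

Section LinearCategory.
Variables (k : fieldType) (C : linCategory k).
Implicit Types X Y Z W S T : Ob C.

Lemma compDl X Y Z (f g : Hom Y Z) (h : Hom X Y) :
  (f + g) \o h = (f \o h) + (g \o h).
Proof. by rewrite -[f]scale1r comp_linl !scale1r. Qed.

Lemma compDr X Y Z (f g : Hom X Y) (h : Hom Y Z) :
  h \o (f + g) = (h \o f) + (h \o g).
Proof. by rewrite -[f]scale1r comp_linr !scale1r. Qed.

Lemma comp0f X Y Z (h : Hom X Y) : (0 : Hom Y Z) \o h = 0.
Proof. by apply: (addrI (0 \o h)); rewrite -compDl !addr0. Qed.

Lemma compf0 X Y Z (h : Hom Y Z) : h \o (0 : Hom X Y) = 0.
Proof. by apply: (addrI (h \o 0)); rewrite -compDr !addr0. Qed.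

Lemma compBr X Y Z (f g : Hom X Y) (h : Hom Y Z) :
  h \o (f - g) = (h \o f) - (h \o g).
Proof. by apply: (addIr (h \o g)); rewrite -compDr !subrK. Qed.

Lemma compBl X Y Z (f g : Hom Y Z) (h : Hom X Y) :
  (f - g) \o h = (f \o h) - (g \o h).
Proof. by apply: (addIr (g \o h)); rewrite -compDl !subrK. Qed.

Lemma comp_suml X Y Z n (f : 'I_n -> Hom Y Z) (h : Hom X Y) :
  (\sum_i f i) \o h = \sum_i (f i \o h).
Proof.
by apply: (big_morph (fun g => g \o h)) => [g g'|]; rewrite ?compDl ?comp0f.
Qed.

Lemma is_zeroP X : is_zero X <-> idm X = 0.
Proof.
split=> [X0|X0 Y]; first exact: (X0 X).1.
by split=> f; [rewrite -[f]compf1 X0 compf0 | rewrite -[f]comp1f X0 comp0f].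
Qed.

Lemma isomorphic_refl X : isomorphic X X.
Proof. by exists (idm _), (idm _); split; rewrite comp1f. Qed.

Lemma isomorphic_sym X Y : isomorphic X Y -> isomorphic Y X.
Proof. by case=> f [g [gf fg]]; exists g, f; split. Qed.

Lemma isomorphic_trans X Y Z :
  isomorphic X Y -> isomorphic Y Z -> isomorphic X Z.
Proof.
move=> [f [f' [ff1 ff2]]] [g [g' [gg1 gg2]]].
exists (g \o f), (f' \o g'); split.
  by rewrite -compA [g' \o _]compA gg1 comp1f.
by rewrite -compA [f \o _]compA ff2 comp1f.
Qed.

Definition hdim X Y : nat := dim (Hom X Y).

Lemma hdim_eq0 X Y : hdim X Y = 0%N <-> (forall f : Hom X Y, f = 0).
Proof. exact: iff_sym (dim_eq0 _). Qed.

Lemma hdim_self_eq0 X : hdim X X = 0%N <-> is_zero X.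
Proof.
split=> [/hdim_eq0 X0|X0]; first by apply/is_zeroP.
by apply/hdim_eq0 => f; apply: (X0 X).1.
Qed.

Lemma hdim_iso X X' Y Y' :
  isomorphic X X' -> isomorphic Y Y' -> hdim X Y = hdim X' Y'.
Proof.
have le A A' B B' : isomorphic A A' -> isomorphic B B' ->
    (hdim A B <= hdim A' B')%N.
  move=> [a [a' [a'a aa']]] [b [b' [b'b bb']]].
  apply: (@dim_inj_le _ _ _ (fun f => b \o f \o a')) => [c f g|f g e].
    by rewrite comp_linr comp_linl.
  have := congr1 (fun h => b' \o h \o a) e.
  by rewrite -!compA a'a !compf1 !compA b'b !comp1f.
move=> XX' YY'; apply/eqP.
by rewrite eqn_leq !le //; apply: isomorphic_sym.
Qed.

(** Binary direct sums, in the form in which extensions of simple objects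
    split them off one at a time. *)
Definition biprod Y S X : Prop :=
  exists (i : Hom Y X) (p : Hom X Y) (j : Hom S X) (q : Hom X S),
    [/\ p \o i = idm Y, q \o j = idm S, p \o j = 0, q \o i = 0
      & (i \o p) + (j \o q) = idm X].

(** Each inequality comes from an injective linear map, given by composing with
    the two projections or with the two injections. *)
Lemma hdim_biprod Y S X : biprod Y S X ->
  forall T, hdim T X = (hdim T Y + hdim T S)%N /\
            hdim X T = (hdim Y T + hdim S T)%N.
Proof.
move=> [i [p [j [q [pi qj pj qi ipjq]]]]] T.
split; apply/eqP; rewrite eqn_leq; apply/andP; split.
- apply: (@dim_inj_le _ (Hom T X) (Hom T Y * Hom T S)%type
           (fun f => (p \o f, q \o f))) => [a f g|f g [ep eq]].
    by rewrite !comp_linr.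
  by rewrite -[f]comp1f -[g]comp1f -ipjq !compDl -!compA ep eq.
- apply: (@dim_inj_le _ (Hom T Y * Hom T S)%type (Hom T X)
           (fun f => (i \o f.1) + (j \o f.2))) => [a f g|[f f'] [g g'] /= e].
    by rewrite /= !comp_linr scalerDr addrACA.
  have := congr1 (fun h => p \o h) e; have := congr1 (fun h => q \o h) e.
  by rewrite !compDr !compA pi qj pj qi !comp0f !comp1f !addr0 !add0r => -> ->.
- apply: (@dim_inj_le _ (Hom X T) (Hom Y T * Hom S T)%type
           (fun f => (f \o i, f \o j))) => [a f g|f g [ei ej]].
    by rewrite !comp_linl.
  by rewrite -[f]compf1 -[g]compf1 -ipjq !compDr !compA ei ej.
- apply: (@dim_inj_le _ (Hom Y T * Hom S T)%type (Hom X T)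
           (fun f => (f.1 \o p) + (f.2 \o q))) => [a f g|[f f'] [g g'] /= e].
    by rewrite /= !comp_linl scalerDr addrACA.
  have := congr1 (fun h => h \o i) e; have := congr1 (fun h => h \o j) e.
  by rewrite !compDl -!compA pi qj pj qi !compf0 !compf1 !addr0 !add0r => -> ->.
Qed.

Lemma biprod_zerol Y S X : biprod Y S X -> is_zero Y -> isomorphic S X.
Proof.
move=> [i [p [j [q [pi qj pj qi ipjq]]]]] Y0; exists j, q; split=> //.
by rewrite -ipjq ((Y0 X).1 i) comp0f add0r.
Qed.

Section Abelian.
Hypothesis abelC : is_abelian C.

Lemma simple_iso S T : isomorphic S T -> simple S -> simple T.
Proof.
move=> [a [b [ba ab]]] [S0 Sm]; split.
  move=> T0; apply: S0; apply/is_zeroP.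
  by rewrite -ba ((T0 S).1 b) comp0f.
move=> Y f fm; have [] := Sm Y (b \o f).
- move=> W g h e; apply: fm.
  by rewrite -[f]comp1f -ab -!compA [b \o _]compA e -!compA.
- by left.
move=> [c [cbf bfc]]; right; exists (c \o b); split; first by rewrite -compA.
have := congr1 (fun h => a \o h \o b) bfc.
by rewrite !compf1 ab !compA ab comp1f -!compA.
Qed.

Lemma schur_iso S T (f : Hom S T) : simple S -> simple T -> f != 0 -> is_iso f.
Proof.
move=> [S0 Sm] [T0 Tm] fN0; have [_ kers _ _ _] := abelC.
have [K [i [fi iker]]] := kers _ _ f.
have im : is_mono i.
  move=> W g h e; have [|u [_ uu]] := iker W (i \o g).
    by rewrite compA fi comp0f.
  by rewrite -(uu g) // -(uu h).
(* If the kernel were all of S, then f would be zero. *)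
have [K0|[j [ji ij]]] := Sm K i im; last first.
  by case/eqP: fN0; rewrite -[f]compf1 -ij compA fi comp0f.
have fm : is_mono f.
  move=> W g h e; apply/eqP; rewrite -subr_eq0; apply/eqP.
  have [|u [<- _]] := iker W (g - h); first by rewrite compBr e subrr.
  by rewrite ((K0 W).2 u) compf0.
have [/is_zeroP S00|//] := Tm S f fm.
by case: S0; apply/is_zeroP.
Qed.

End Abelian.

End LinearCategory.

Section ClosedField.
Variables (k : closedFieldType) (C : linCategory k).
Implicit Types X Y Z W S T : Ob C.
Hypothesis abelC : is_abelian C.

(** Over an algebraically closed field an endomorphism of a simple object [S]
    has an eigenvalue, as it acts on the non-zero finite-dimensional space of
    endomorphisms by composition; subtracting that eigenvalue gives a
    non-invertible, hence zero, endomorphism. *)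
Lemma schur_hdim S T : simple S -> simple T -> hdim S T = `[< isomorphic S T >].
Proof.
move=> sS sT; have [ST|nST] := asboolP (isomorphic S T); last first.
  apply/hdim_eq0 => f; apply/eqP/negP => /negP fN0.
  by apply: nST; exists f; apply: schur_iso.
have {T sT ST}-> : hdim S T = hdim S S.
  by apply: hdim_iso (isomorphic_sym ST); apply: isomorphic_refl.
have SN0 : (0 < hdim S S)%N by rewrite lt0n; apply/eqP => /hdim_self_eq0 /sS.1.
apply/eqP; rewrite eqn_leq SN0 andbT.
have scal (f : Hom S S) : exists a, f = a *: idm S.
  have lin_f : linear (fun g : Hom S S => f \o g).
    by move=> c g h; apply: comp_linr.
  have [a [g [gN0 fg]]] := closed_eigenvector lin_f SN0.
  exists a; apply/eqP; rewrite -subr_eq0; apply: contraT => fN0.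
  have [h [hf _]] := schur_iso abelC sS sS fN0.
  case/eqP: gN0; rewrite -[g]comp1f -hf -compA.
  rewrite compBl fg; have -> : (a *: idm S) \o g = a *: g.
    by rewrite -[_ *: _]addr0 comp_linl comp1f comp0f addr0.
  by rewrite subrr compf0.
rewrite /hdim -dimvf (leq_trans (n := \dim <[idm S]>%VS)) //.
  by apply/dimvS/subvP => f _; have [a ->] := scal f; rewrite memvZ ?memv_line.
by rewrite dim_vline leq_b1.
Qed.

End ClosedField.

(** * Splitting *)

Section Semisimple.
Variables (k : fieldType) (C : linCategory k).
Implicit Types X Y Z W S T : Ob C.
Hypotheses (abelC : is_abelian C) (ssC : semisimple C).

(** Some component of [f] is a non-zero morphism between simple objects, and its
    inverse provides the retraction. *)
Lemma simple_retract S X (f : Hom S X) :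
  simple S -> f != 0 -> exists g : Hom X S, g \o f = idm S.
Proof.
move=> sS fN0; have [n [T [sT [i [p [_ _ ipE]]]]]] := ssC X.
have [j pfN0] : exists j, p j \o f != 0.
  apply: contrapT => /forallNP pf0; case/eqP: fN0.
  rewrite -[f]comp1f -ipE comp_suml big1 // => j _; rewrite -compA.
  by have /negP/negPn/eqP-> := pf0 j; rewrite compf0.
have [g [gf _]] := schur_iso abelC sS (sT j) pfN0.
by exists (g \o p j); rewrite -compA.
Qed.

Lemma simple_section S X (f : Hom X S) :
  simple S -> f != 0 -> exists g : Hom S X, f \o g = idm S.
Proof.
move=> sS fN0; have [n [T [sT [i [p [_ _ ipE]]]]]] := ssC X.
have [j fiN0] : exists j, f \o i j != 0.
  apply: contrapT => /forallNP fi0; case/eqP: fN0.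
  rewrite -[f]compf1 -ipE.
  rewrite (big_morph (fun g => f \o g) (id1 := 0) (op1 := +%R)) => [|g h|].
  - by apply: big1 => j _; rewrite compA;
      have /negP/negPn/eqP-> := fi0 j; rewrite comp0f.
  - exact: compDr.
  - exact: compf0.
have [g [_ fg]] := schur_iso abelC (sT j) sS fiN0.
by exists (i j \o g); rewrite compA.
Qed.

(** With [j] a section of [g], the projection to [Y] is the factorization of
    [1 - j g] through the kernel [f] of [g]. *)
Lemma short_exact_biprod Y X S (f : Hom Y X) (g : Hom X S) :
  simple S -> short_exact f g -> biprod Y S X.
Proof.
move=> sS [[gf fker] [_ gcok]].
have fm W (u v : Hom W Y) : f \o u = f \o v -> u = v.
  move=> e; have [|w [_ ww]] := fker W (f \o u).
    by rewrite compA gf comp0f.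
  by rewrite -(ww u) // -(ww v).
have gN0 : g != 0.
  apply/eqP => g0; apply: sS.1; apply/is_zeroP.
  have [|w [_ ww]] := gcok S 0; first by rewrite comp0f.
  by rewrite -(ww (idm S)) ?g0 ?compf0 // -(ww 0) ?comp0f.
have [j gj] := simple_section sS gN0.
have [|p [fp _]] := fker X (idm X - (j \o g)).
  by rewrite compBr compf1 compA gj comp1f subrr.
exists f, p, j, g; split=> //; last by rewrite fp subrK.
  by apply: fm; rewrite compA fp compBl comp1f -compA gf compf0 subr0 compf1.
by apply: fm; rewrite compA fp compBl comp1f -compA gj compf1 subrr compf0.
Qed.

End Semisimple.

(** * The reversed monoidal category *)

Section Inverses.
Variables (k : fieldType) (C : monCategory k).
Implicit Types X Y Z W V : C.

Lemma inverse_uniq X Y (f : Hom X Y) (g h : Hom Y X) :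
  is_inverse f g -> is_inverse f h -> g = h.
Proof. by move=> [_ fg] [hf _]; rewrite -[g]comp1f -hf -compA fg compf1. Qed.

Lemma inverse_sym X Y (f : Hom X Y) (g : Hom Y X) :
  is_inverse f g -> is_inverse g f.
Proof. by case. Qed.

Lemma inverse_comp X Y Z (f : Hom X Y) (f' : Hom Y X) (g : Hom Y Z)
    (g' : Hom Z Y) :
  is_inverse f f' -> is_inverse g g' -> is_inverse (g \o f) (f' \o g').
Proof.
move=> [f'f ff'] [g'g gg']; split.
  by rewrite -compA [g' \o _]compA g'g comp1f.
by rewrite -compA [f \o _]compA ff' comp1f.
Qed.

Lemma inverse_id X : is_inverse (idm X) (idm X).
Proof. by split; rewrite comp1f. Qed.

Lemma inverse_tens X X' Y Y' (f : Hom X X') (f' : Hom X' X) (g : Hom Y Y')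
    (g' : Hom Y' Y) :
  is_inverse f f' -> is_inverse g g' -> is_inverse (f \om g) (f' \om g').
Proof.
move=> [f'f ff'] [g'g gg'].
by split; rewrite -tensmM ?f'f ?g'g ?ff' ?gg' tensm1.
Qed.

Lemma tens_iso X X' Y Y' :
  isomorphic X X' -> isomorphic Y Y' -> isomorphic (X \ox Y) (X' \ox Y').
Proof.
move=> [f [f' ff']] [g [g' gg']]; exists (f \om g), (f' \om g').
exact: inverse_tens.
Qed.

Lemma assoc_iso X Y Z : isomorphic ((X \ox Y) \ox Z) (X \ox (Y \ox Z)).
Proof. by exists (assoc X Y Z), (assocV X Y Z); apply: assoc_inv. Qed.

Lemma lunit_iso X : isomorphic (unit_ob C \ox X) X.
Proof. by exists (lunit X), (lunitV X); apply: lunit_inv. Qed.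

Lemma runit_iso X : isomorphic (X \ox unit_ob C) X.
Proof. by exists (runit X), (runitV X); apply: runit_inv. Qed.

Lemma lunitV_nat X Y (f : Hom X Y) :
  lunitV Y \o f = (idm (unit_ob C) \om f) \o lunitV X.
Proof.
rewrite -[LHS]compf1 -(lunit_inv X).2 compA -[X in X \o _]compA -lunit_nat.
by rewrite compA (lunit_inv Y).1 comp1f.
Qed.

Lemma runitV_nat X Y (f : Hom X Y) :
  runitV Y \o f = (f \om idm (unit_ob C)) \o runitV X.
Proof.
rewrite -[LHS]compf1 -(runit_inv X).2 compA -[X in X \o _]compA -runit_nat.
by rewrite compA (runit_inv Y).1 comp1f.
Qed.

Lemma assocV_nat X X' Y Y' Z Z' (f : Hom X X') (g : Hom Y Y') (h : Hom Z Z') :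
  assocV X' Y' Z' \o (f \om (g \om h)) = ((f \om g) \om h) \o assocV X Y Z.
Proof.
rewrite -[LHS]compf1 -(assoc_inv X Y Z).2 compA -[X in X \o _]compA -assoc_nat.
by rewrite compA (assoc_inv X' Y' Z').1 comp1f.
Qed.

Lemma pentagonV W X Y Z :
  assocV (W \ox X) Y Z \o assocV W X (Y \ox Z) =
  (assocV W X Y \om idm Z) \o
    (assocV W (X \ox Y) Z \o (idm W \om assocV X Y Z)).
Proof.
apply: (@inverse_uniq _ _ (assoc W X (Y \ox Z) \o assoc (W \ox X) Y Z)).
  exact: inverse_comp (assoc_inv _ _ _) (assoc_inv _ _ _).
rewrite pentagon (compA (assocV W X Y \om _)).
apply: inverse_comp; last exact: inverse_tens (inverse_id _) (assoc_inv _ _ _).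
by apply: inverse_comp; [apply: inverse_tens (inverse_id _)|]; apply: assoc_inv.
Qed.

Lemma triangle_assocV X Y :
  (runit X \om idm Y) \o assocV X (unit_ob C) Y = idm X \om lunit Y.
Proof. by rewrite -triangle -compA (assoc_inv X _ Y).2 compf1. Qed.

(** Exchanging the two tensor factors turns left duals into right duals and the
    right unitor into the left one, so each coherence or duality statement
    yields its mirror image. *)
Definition rev_cat : monCategory k.
Proof.
refine (@MonCategory k C (fun X Y => Y \ox X) (unit_ob C)
  (fun _ _ _ _ f g => g \om f) _ _ _ _
  (fun X Y Z => assocV Z Y X) (fun X Y Z => assoc Z Y X) _ _
  (@runit k C) (@runitV k C) _ _ (@lunit k C) (@lunitV k C) _ _ _ _).
- by move=> X Y; apply: tensm1.
- by move=> *; apply: tensmM.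
- by move=> *; apply: tensm_linr.
- by move=> *; apply: tensm_linl.
- by move=> X Y Z; apply/inverse_sym/assoc_inv.
- by move=> *; apply: assocV_nat.
- exact: runit_inv.
- by move=> *; apply: runit_nat.
- exact: lunit_inv.
- by move=> *; apply: lunit_nat.
- by move=> W X Y Z; apply: pentagonV.
- by move=> X Y; apply: triangle_assocV.
Defined.

End Inverses.

Section Coherence.
Variables (k : fieldType) (C : monCategory k).
Implicit Types X Y Z W V : C.
Local Notation one := (unit_ob C).

Lemma is_left_dual_rev X Y :
  is_left_dual X Y -> @is_left_dual k (rev_cat C) Y X.
Proof. by move=> [ev [coev [zX zY]]]; exists ev, coev. Qed.

Lemma lunit_tens X Y :
  lunit (X \ox Y) \o assoc one X Y = lunit X \om idm Y.
Proof.
have /= <- := @runit_tens k (rev_cat C) Y X.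
by rewrite -compA (assoc_inv _ _ _).1 compf1.
Qed.

(** Naturality of the left unitor at itself gives
    [lunit (1 \ox 1) = 1 \ox lunit 1]; feeding this in the triangle axiom
    identifies both unitors after tensoring with the unit. *)
Lemma lunit_runit_one : lunit one = runit one.
Proof.
have lunit1 : lunit (one \ox one) = idm one \om lunit one.
  have := lunit_nat (lunit one); move=> /(congr1 (fun f => lunitV one \o f)).
  by rewrite /= !compA (lunit_inv one).1 !comp1f.
by apply: tensm_unit_inj; rewrite -triangle -lunit_tens lunit1.
Qed.

Lemma tensmMl X Y Z W (g : Hom Y Z) (f : Hom X Y) :
  (g \o f) \om idm W = (g \om idm W) \o (f \om idm W).
Proof. by rewrite -tensmM comp1f. Qed.

Lemma tensmMr X Y Z W (g : Hom Y Z) (f : Hom X Y) :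
  idm W \om (g \o f) = (idm W \om g) \o (idm W \om f).
Proof. by rewrite -tensmM comp1f. Qed.

Lemma tensm_exchange X X' Y Y' (f : Hom X X') (g : Hom Y Y') :
  (f \om idm Y') \o (idm X \om g) = (idm X' \om g) \o (f \om idm Y).
Proof. by rewrite -!tensmM !comp1f !compf1. Qed.

Lemma runitV_tens X W :
  runitV X \om idm W = assocV X one W \o (idm X \om lunitV W).
Proof.
apply: (@inverse_uniq k C _ _ (runit X \om idm W)).
  exact: inverse_tens (runit_inv _) (inverse_id _).
rewrite -triangle; apply: inverse_comp (assoc_inv _ _ _) _.
exact: inverse_tens (inverse_id _) (lunit_inv _).
Qed.

Lemma lunitV_tens X W :
  lunitV X \om idm W = assocV one X W \o lunitV (X \ox W).
Proof.
apply: (@inverse_uniq k C _ _ (lunit X \om idm W)).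
  exact: inverse_tens (lunit_inv _) (inverse_id _).
rewrite -lunit_tens; apply: inverse_comp (assoc_inv _ _ _) _.
exact: lunit_inv.
Qed.

(** Two forms of the pentagon axiom in which some of the associators are
    inverted, as they occur when a zigzag is moved past a tensor factor. *)
Lemma pentagon_mixed1 W X Y Z :
  assoc (W \ox X) Y Z \o (assocV W X Y \om idm Z) \o assocV W (X \ox Y) Z =
  assocV W X (Y \ox Z) \o (idm W \om assoc X Y Z).
Proof.
have e := pentagonV W X Y Z.
have := congr1 (fun f => assoc (W \ox X) Y Z \o f \o (idm W \om assoc X Y Z)) e.
rewrite /= !compA (assoc_inv (W \ox X) Y Z).2 comp1f => ->.
by rewrite -[in RHS]compA -tensmMr (assoc_inv X Y Z).1 tensm1 compf1.
Qed.

Lemma pentagon_mixed2 W X Y Z :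
  assoc W (X \ox Y) Z \o (assoc W X Y \om idm Z) \o assocV (W \ox X) Y Z =
  (idm W \om assocV X Y Z) \o assoc W X (Y \ox Z).
Proof.
have e := pentagon W X Y Z.
have := congr1
  (fun f => (idm W \om assocV X Y Z) \o f \o assocV (W \ox X) Y Z) e.
rewrite /= -!compA (assoc_inv (W \ox X) Y Z).2 compf1 => ->.
by rewrite !compA -tensmMr (assoc_inv X Y Z).1 tensm1 comp1f.
Qed.

(** * Duality *)

Section Zigzag.
Variables (X Y : C) (ev : Hom (Y \ox X) one) (coev : Hom one (X \ox Y)).

(** The composite that appears when one transposes a morphism twice along the
    duality is the zigzag tensored with the spectator object [W], up to moving
    parentheses. *)
Lemma zigzag_tens1 W :
  lunit (Y \ox W) \o (ev \om idm (Y \ox W)) \o assocV Y X (Y \ox W) \o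
    (idm Y \om assoc X Y W) \o (idm Y \om (coev \om idm W)) \o
    (idm Y \om lunitV W) =
  (lunit Y \o (ev \om idm Y) \o assocV Y X Y \o (idm Y \om coev) \o runitV Y)
    \om idm W.
Proof.
rewrite !tensmMl runitV_tens -lunit_tens.
rewrite [RHS]compA; congr (_ \o _).
rewrite -[RHS]compA -assocV_nat [RHS]compA; congr (_ \o _).
rewrite -(compA (lunit (Y \ox W)) (assoc one Y W)) assoc_nat tensm1 -!compA.
by do 2!congr (_ \o _); rewrite compA pentagon_mixed1.
Qed.

Lemma zigzag_tens2 V :
  (idm X \om lunit V) \o (idm X \om (ev \om idm V)) \o
    (idm X \om assocV Y X V) \o assoc X Y (X \ox V) \o
    (coev \om idm (X \ox V)) \o lunitV (X \ox V) =
  (runit X \o (idm X \om ev) \o assoc X Y X \o (coev \om idm X) \o lunitV X)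
    \om idm V.
Proof.
rewrite !tensmMl lunitV_tens -triangle.
rewrite [RHS]compA; congr (_ \o _).
rewrite -[RHS]compA -assocV_nat tensm1 [RHS]compA; congr (_ \o _).
rewrite -(compA (idm X \om lunit V) (assoc X one V)) assoc_nat -!compA.
by do 2!congr (_ \o _); rewrite compA pentagon_mixed2.
Qed.

End Zigzag.

(** If [Y] is a left dual of [X], then [Y \ox -] is left adjoint to
    [X \ox -]. *)
Lemma hdim_left_dual X Y W V :
  is_left_dual X Y -> hdim (Y \ox W) V = hdim W (X \ox V).
Proof.
move=> [ev [coev [zX zY]]].
pose phi (f : Hom (Y \ox W) V) : Hom W (X \ox V) :=
  (idm X \om f) \o assoc X Y W \o (coev \om idm W) \o lunitV W.
pose psi (g : Hom W (X \ox V)) : Hom (Y \ox W) V :=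
  lunit V \o (ev \om idm V) \o assocV Y X V \o (idm Y \om g).
have phiK f : psi (phi f) = f.
  rewrite -[RHS]compf1 -tensm1 -zY -zigzag_tens1 /psi /phi !tensmMr.
  rewrite !compA; do 3!congr (_ \o _).
  rewrite -!compA assocV_nat !compA; congr (_ \o _).
  rewrite -lunit_nat -!compA; congr (_ \o _).
  by rewrite tensm1 tensm_exchange.
have psiK g : phi (psi g) = g.
  rewrite -[RHS]comp1f -tensm1 -zX -zigzag_tens2 /psi /phi !tensmMr -!compA.
  do 3!congr (_ \o _).
  rewrite lunitV_nat (compA (coev \om _)) tensm_exchange -tensm1.
  by rewrite -compA compA -assoc_nat -compA.
apply/eqP; rewrite eqn_leq; apply/andP; split.
  apply: (@dim_inj_le _ _ _ phi) => [a f g|]; last exact: can_inj phiK.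
  by rewrite /phi tensm_linr !comp_linl.
apply: (@dim_inj_le _ _ _ psi) => [a f g|]; last exact: can_inj psiK.
by rewrite /psi tensm_linr !comp_linr.
Qed.

End Coherence.

(** If [Y] is a left dual of [X], then [- \ox X] is left adjoint to
    [- \ox Y]: this is the previous adjunction in the reversed category. *)
Lemma hdim_right_dual (k : fieldType) (C : monCategory k) (X Y W V : C) :
  is_left_dual X Y -> hdim (W \ox X) V = hdim W (V \ox Y).
Proof.
by move=> /is_left_dual_rev; apply: (@hdim_left_dual k (rev_cat C)).
Qed.

(** * Separability of the free module functors *)

Section Separability.
Variables (k : fieldType) (C : monCategory k).
Implicit Types X Y Z W : C.
Local Notation one := (unit_ob C).

Lemma tensmDl X X' Y Y' (f g : Hom X X') (h : Hom Y Y') :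
  (f + g) \om h = (f \om h) + (g \om h).
Proof. by rewrite -[f]scale1r tensm_linl !scale1r. Qed.

Lemma tensm0l X X' Y Y' (h : Hom Y Y') : (0 : Hom X X') \om h = 0.
Proof. by apply: (addrI (0 \om h)); rewrite -tensmDl !addr0. Qed.

Lemma tensmDr X X' Y Y' (f g : Hom X X') (h : Hom Y Y') :
  h \om (f + g) = (h \om f) + (h \om g).
Proof. by rewrite -[f]scale1r tensm_linr !scale1r. Qed.

Lemma tensm0r X X' Y Y' (h : Hom Y Y') : h \om (0 : Hom X X') = 0.
Proof. by apply: (addrI (h \om 0)); rewrite -tensmDr !addr0. Qed.

(** Precomposing with the unit of [A] and postcomposing with its retraction [c]
    is a natural left inverse of [f |-> f \om idm A]. *)
Lemma unit_retract_separable (A : algebra C) (c : Hom A one) :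
  c \o alg_unit A = idm one -> separable (free_functor A).
Proof.
move=> cu.
exists (fun X Y (h : rmod_hom (free_rmodule A X) (free_rmodule A Y)) =>
  runit Y \o (idm Y \om c) \o h \o (idm X \om alg_unit A) \o runitV X).
split=> [X Y f | X X' Y Y' f g h] /=.
  rewrite -2!(compA (runit Y)) -tensm_exchange -!compA (compA (idm X \om c)).
  rewrite -tensmM cu comp1f tensm1 comp1f compA runit_nat -compA.
  by rewrite (runit_inv X).2 compf1.
rewrite -!compA runitV_nat (compA (f \om idm A)) tensm_exchange.
rewrite (compA (idm Y' \om c)) -tensm_exchange -!compA (compA (runit Y')).
by rewrite runit_nat -!compA.
Qed.

Lemma alg_unit_neq0 (A : algebra C) : ~ is_zero (alg_ob A) -> alg_unit A != 0.
Proof.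
move=> A0; apply/eqP => u0; apply: A0; apply/is_zeroP.
rewrite -(lunit_inv A).2 -[lunit _]alg_mul1l u0.
by rewrite tensm0l compf0 comp0f.
Qed.

Lemma separable_faithful (D : category) (F : functor C D) X Y (f g : Hom X Y) :
  separable F -> fun_map F f = fun_map F g -> f = g.
Proof. by move=> [P [PF _]] e; rewrite -(PF _ _ f) e PF. Qed.

Section UnitRetract.
Variables (S : C) (i : Hom S one) (p : Hom one S).
Hypothesis pK : p \o i = idm S.

(** A retract [S] of the unit object is an algebra: the unit is the projection
    [p], and the multiplication is that of the unit object, restricted along
    [i] and projected by [p]. *)
Definition retract_mul : Hom (S \ox S) S := p \o lunit one \o (i \om i).

(** By naturality of the unitors the idempotent [i \o p] can be moved through
    the multiplication of the unit object, where [p] absorbs it; on the second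
    side this uses that both unitors of the unit object agree. *)
Lemma retract_absorbr :
  p \o lunit one \o (idm one \om (i \o p)) = p \o lunit one.
Proof. by rewrite -compA lunit_nat !compA pK comp1f. Qed.

Lemma retract_absorbl :
  p \o lunit one \o ((i \o p) \om idm one) = p \o lunit one.
Proof. by rewrite -compA lunit_runit_one runit_nat !compA pK comp1f. Qed.

Lemma retract_mulA : retract_mul \o (retract_mul \om idm S) =
  retract_mul \o (idm S \om retract_mul) \o assoc S S S.
Proof.
have mE : (i \o retract_mul) = (i \o p) \o (lunit one \o (i \om i)).
  by rewrite /retract_mul -!compA.
have mulL : (i \om i) \o (retract_mul \om idm S) =
    ((i \o p) \om idm one) \o ((lunit one \om idm one) \o ((i \om i) \om i)).
  by rewrite -!tensmM compf1 !comp1f mE.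
have mulR : (i \om i) \o (idm S \om retract_mul) \o assoc S S S =
    (idm one \om (i \o p)) \o ((lunit one \om idm one) \o ((i \om i) \om i)).
  have -> : (i \om i) \o (idm S \om retract_mul) =
      (idm one \om (i \o p)) \o
        ((idm one \om lunit one) \o (i \om (i \om i))).
    by rewrite -!tensmM compf1 !comp1f mE.
  rewrite -!compA -assoc_nat (compA (idm one \om lunit one)).
  by rewrite triangle lunit_runit_one.
rewrite {1 3}/retract_mul -[LHS]compA mulL -2![RHS]compA (compA (i \om i)) mulR.
by rewrite !(compA (p \o _)) retract_absorbr retract_absorbl.
Qed.

Lemma retract_mul1l : retract_mul \o (p \om idm S) = lunit S.
Proof.
have e : (i \om i) \o (p \om idm S) = ((i \o p) \om idm one) \o (idm one \om i).
  by rewrite -!tensmM !compf1 comp1f.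
rewrite /retract_mul -compA e compA retract_absorbl.
by rewrite -compA lunit_nat compA pK comp1f.
Qed.

Lemma retract_mul1r : retract_mul \o (idm S \om p) = runit S.
Proof.
rewrite /retract_mul -compA -tensmM compf1 -[X in X \om _]comp1f.
rewrite -[X in _ \om X]compf1 tensmM compA retract_absorbr.
by rewrite -compA lunit_runit_one runit_nat compA pK comp1f.
Qed.

Definition retract_algebra : algebra C :=
  Algebra retract_mulA retract_mul1l retract_mul1r.

(** Endomorphisms of the unit act on either tensor factor in the same way, so
    [e] can be moved onto [S], where it composes with [i] to zero. *)
Lemma retract_tens_eq0 (e : Hom one one) : e \o i = 0 -> e \om idm S = 0.
Proof.
move=> ei.
have ei0 : (e \om idm one) \o (idm one \om i) = 0.
  rewrite -[LHS]comp1f -(lunit_inv one).1 -compA (compA (lunit one)).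
  rewrite (lunit_runit_one C) runit_nat -lunit_runit_one -compA lunit_nat.
  by rewrite (compA e) ei comp0f compf0.
have -> : e \om idm S = (idm one \om p) \o ((e \om idm one) \o (idm one \om i)).
  by rewrite -!tensmM !comp1f compf1 pK.
by rewrite ei0 compf0.
Qed.

End UnitRetract.

End Separability.

(** * Additive maps on free abelian groups *)

Section FreeAbelian.
Variable I : choiceType.
Implicit Types D : {freeg I}.

(** Identities between expressions that are additive in each variable need only
    be checked on basis elements. *)
Lemma freeg_ind (P : {freeg I} -> Prop) :
  P 0 -> (forall D E, P D -> P E -> P (D - E)) -> (forall i, P << i >>) ->
  forall D, P D.
Proof.
move=> P0 PB Pgen D.
have PD E F : P E -> P F -> P (E + F).
  move=> PE PF; have -> : E + F = E - (0 - F) by rewrite sub0r opprK.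
  exact: PB PE (PB _ _ P0 PF).
have PMn E n : P E -> P (E *+ n).
  by move=> PE; elim: n => [|n IHn]; rewrite ?mulr0n // mulrS; apply: PD.
rewrite -(freeg_sumE D); elim/big_ind: _ => // i _.
rewrite -[coeff i D]intz -freegU_mulz.
case: (coeff i D) => n; first exact: PMn.
by rewrite NegzE mulrNz -sub0r; apply: PB P0 _; apply: (PMn _ n.+1).
Qed.

Lemma fgliftU (M : lmodType int) (f : I -> M) i : fglift f << i >> = f i.
Proof. by rewrite liftU scale1r. Qed.

Lemma fgliftB (M : lmodType int) (f : I -> M) D E :
  fglift f (D - E) = fglift f D - fglift f E.
Proof. exact: lift_is_additive. Qed.

Lemma fglift0 (M : lmodType int) (f : I -> M) : fglift f (0 : {freeg I}) = 0.
Proof. by rewrite -[X in fglift f X](subrr 0) fgliftB subrr. Qed.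

Lemma fglift_funB (M : lmodType int) (f g : I -> M) D :
  fglift (fun i => f i - g i) D = fglift f D - fglift g D.
Proof.
elim/freeg_ind: D => [|D E eD eE|i]; first by rewrite !fglift0 subrr.
  by rewrite !fgliftB eD eE opprD addrACA -opprD.
by rewrite !fgliftU.
Qed.

Lemma freeg_coeff_eq D E : (forall i, coeff i D = coeff i E) -> D = E.
Proof. by move=> e; apply/eqP/freeg_eqP. Qed.

End FreeAbelian.

(** * The Grothendieck ring of a semisimple category *)

Section GrothendieckClass.
Variables (k : fieldType) (C : monCategory k).
Implicit Types X Y Z W : C.
Hypothesis lfC : locally_finite C.

Lemma gr_classE X : exists2 s, composition_series X s &
  gr_class X = \sum_(S <- s) << (\pi_(simple_class C) S)%qT >>.
Proof.
rewrite /gr_class; case: xgetP => [s _ Xs|no]; first by exists s.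
by have [s /no] := lfC X.
Qed.

Lemma simple_class_eq (S T : simpleObj C) :
  (\pi_(simple_class C) S == \pi_(simple_class C) T)%qT = `[< isomorphic S T >].
Proof. exact: eqmodE. Qed.

Lemma repr_iso (S : simpleObj C) :
  isomorphic (repr (\pi_(simple_class C) S)%qT) S.
Proof. by apply/asboolP; rewrite -simple_class_eq reprK. Qed.

End GrothendieckClass.

(** * The Grothendieck ring and duality *)

Section TensorBiproduct.
Variables (k : fieldType) (C : monCategory k).
Implicit Types X Y Z W S : C.

Lemma biprod_tensl Y S X Z :
  biprod Y S X -> biprod (Y \ox Z) (S \ox Z) (X \ox Z).
Proof.
move=> [i [p [j [q [pi qj pj qi ipjq]]]]].
exists (i \om idm Z), (p \om idm Z), (j \om idm Z), (q \om idm Z).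
by split; rewrite -!tensmMl ?pi ?qj ?pj ?qi -?tensmDl ?ipjq ?tensm1 ?tensm0l.
Qed.

End TensorBiproduct.

Lemma biprod_tensr (k : fieldType) (C : monCategory k) (Y S X Z : C) :
  biprod Y S X -> biprod (Z \ox Y) (Z \ox S) (Z \ox X).
Proof. exact: (@biprod_tensl k (rev_cat C)). Qed.

Section Multifusion.
Variables (k : closedFieldType) (C : monCategory k).
Implicit Types X Y Z W : C.
Hypotheses (abelC : is_abelian C) (lfC : locally_finite C).
Hypothesis ssC : semisimple C.
Local Notation one := (unit_ob C).
Local Notation cls := (\pi_(simple_class C))%qT.

Lemma simpleP (S : simpleObj C) : simple S.
Proof. by case: S. Qed.
Hint Resolve simpleP : core.

(** By semisimplicity the steps of a Jordan-Hölder series split, which gives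
    induction on objects by adding simple direct summands. *)
Lemma split_ind (P : C -> Prop) :
  (forall X, is_zero X -> P X) ->
  (forall Y (S : simpleObj C) X, biprod Y S X -> P Y -> P X) ->
  forall X, P X.
Proof.
move=> P0 PS X; have [s Xs] := lfC X.
elim: Xs => [Y|Y Z S s' f g ex _ PY]; first exact: P0.
by apply: PS PY; apply: short_exact_biprod ex.
Qed.

Lemma split_simple X :
  ~ is_zero X -> exists Y (S : simpleObj C), biprod Y S X.
Proof. by elim/split_ind: X => [//|Y S X YSX _ _]; exists Y, S. Qed.

Lemma hdim_zerol X Y : is_zero X -> hdim X Y = 0%N.
Proof. by move=> X0; apply/hdim_eq0; apply: (X0 Y).1. Qed.

Lemma hdim_zeror X Y : is_zero Y -> hdim X Y = 0%N.
Proof. by move=> Y0; apply/hdim_eq0; apply: (Y0 X).2. Qed.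

Lemma hdim_simpleE (S T : simpleObj C) : hdim S T = (cls S == cls T).
Proof. by rewrite simple_class_eq schur_hdim. Qed.

(** Both sides count the multiplicity of [S] in [X]. *)
Lemma hdim_simple_sym (S : simpleObj C) X : hdim S X = hdim X S.
Proof.
elim/split_ind: X => [X X0|Y T X YTX IH].
  by rewrite (hdim_zerol _ X0) (hdim_zeror _ X0).
have [-> ->] := hdim_biprod YTX S.
by rewrite IH !hdim_simpleE eq_sym.
Qed.

(** Splitting off a simple summand [S] already accounts for the dimension 1, so
    the complement has no non-zero endomorphism. *)
Lemma simple_hdim1 X : hdim X X = 1%N -> simple X.
Proof.
elim/split_ind: X => [X X0|Y S X YSX _]; first by rewrite (hdim_zerol _ X0).
have [_ dX] := hdim_biprod YSX X; rewrite dX.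
have [dY _] := hdim_biprod YSX Y; have [dS _] := hdim_biprod YSX S.
rewrite dY dS hdim_simpleE eqxx => d1.
have Y0 : is_zero Y.
  apply/hdim_self_eq0/eqP; move/eqP: d1.
  by rewrite addnA addn1 eqSS !addn_eq0 -!andbA => /and3P[].
by apply: simple_iso (biprod_zerol YSX Y0) _.
Qed.

(** This determines [gr_class X] by quantities that do not mention the chosen
    Jordan-Hölder series. *)
Lemma coeff_gr_class (i : simple_class C) X :
  coeff i (gr_class X) = (hdim (repr i) X)%:R.
Proof.
have [s Xs ->] := gr_classE lfC X.
elim: Xs => [Y Y0|Y Z S s' f g ex _ IH].
  by rewrite big_nil coeff0 (hdim_zeror _ Y0).
have bX := short_exact_biprod abelC ssC (simpleP S) ex.
have [-> _] := hdim_biprod bX (repr i).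
rewrite big_cons coeffD {}IH coeffU mul1r hdim_simpleE reprK.
by rewrite natrD addrC eq_sym.
Qed.

Lemma gr_class_eq X Y :
  (forall S : simpleObj C, hdim S X = hdim S Y) -> gr_class X = gr_class Y.
Proof. by move=> e; apply: freeg_coeff_eq => i; rewrite !coeff_gr_class e. Qed.

Lemma gr_class_iso X Y : isomorphic X Y -> gr_class X = gr_class Y.
Proof.
by move=> XY; apply: gr_class_eq => S; apply: hdim_iso (isomorphic_refl _) XY.
Qed.

Lemma gr_class_zero X : is_zero X -> gr_class X = 0.
Proof.
move=> X0; apply: freeg_coeff_eq => i.
by rewrite coeff_gr_class coeff0 (hdim_zeror _ X0).
Qed.

Lemma gr_class_biprod Y Z X :
  biprod Y Z X -> gr_class X = gr_class Y + gr_class Z.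
Proof.
move=> YZX; apply: freeg_coeff_eq => i; rewrite coeffD !coeff_gr_class.
by have [-> _] := hdim_biprod YZX (repr i); rewrite natrD.
Qed.

Lemma gr_class_simple (S : simpleObj C) : gr_class S = << cls S >>.
Proof.
apply: freeg_coeff_eq => i; rewrite coeff_gr_class coeffU mul1r.
by rewrite hdim_simpleE reprK eq_sym.
Qed.

Lemma gr_class_repr (i : simple_class C) : << i >> = gr_class (repr i).
Proof. by rewrite gr_class_simple reprK. Qed.

Lemma gr_mulBl (x y z : {freeg simple_class C}) :
  gr_mul (x - y) z = gr_mul x z - gr_mul y z.
Proof. exact: fgliftB. Qed.

Lemma gr_mul0l (z : {freeg simple_class C}) : gr_mul 0 z = 0.
Proof. exact: fglift0. Qed.

Lemma gr_mulBr (x y z : {freeg simple_class C}) :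
  gr_mul z (x - y) = gr_mul z x - gr_mul z y.
Proof.
rewrite -fglift_funB; congr (fglift _ z).
by apply/funext => i; apply: fgliftB.
Qed.

Lemma gr_mul0r (z : {freeg simple_class C}) : gr_mul z 0 = 0.
Proof. by rewrite -[X in gr_mul z X](subrr 0) gr_mulBr subrr. Qed.

Lemma gr_mulDl (x y z : {freeg simple_class C}) :
  gr_mul (x + y) z = gr_mul x z + gr_mul y z.
Proof. by apply: (addIr (- gr_mul y z)); rewrite -gr_mulBl !addrK. Qed.

Lemma gr_mulDr (x y z : {freeg simple_class C}) :
  gr_mul z (x + y) = gr_mul z x + gr_mul z y.
Proof. by apply: (addIr (- gr_mul z y)); rewrite -gr_mulBr !addrK. Qed.

(** Both sides are additive in [X] and in [Y], so this reduces to simple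
    objects, where only the choice of representatives intervenes. *)
Lemma gr_mul_class X Y : gr_mul (gr_class X) (gr_class Y) = gr_class (X \ox Y).
Proof.
elim/split_ind: X => [X X0|X' S X XS IHX].
  rewrite (gr_class_zero X0) gr_mul0l gr_class_zero //; apply/is_zeroP.
  by rewrite -tensm1 (is_zeroP X).1 // tensm0l.
rewrite (gr_class_biprod XS) gr_mulDl IHX (gr_class_biprod (biprod_tensl Y XS)).
congr (_ + _) => {X' X XS IHX}.
elim/split_ind: Y => [Y Y0|Y' T Y YT IHY].
  rewrite (gr_class_zero Y0) gr_mul0r gr_class_zero //; apply/is_zeroP.
  by rewrite -tensm1 [idm Y](is_zeroP Y).1 // tensm0r.
rewrite (gr_class_biprod YT) gr_mulDr IHY (gr_class_biprod (biprod_tensr S YT)).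
congr (_ + _); rewrite !gr_class_simple /gr_mul !fgliftU.
by apply/gr_class_iso/tens_iso; apply: repr_iso.
Qed.

Lemma gr_is_Zplus_ring : is_Zplus_ring (Gr C).
Proof.
split; last 2 first.
- move=> i j l /=; rewrite /bd_basis /gr_mul !fgliftU coeff_gr_class.
  exact: ler0n.
- by move=> l /=; rewrite coeff_gr_class ler0n.
split=> /=.
- move=> x y z; elim/freeg_ind: x => [|x x' e e'|i]; first by rewrite !gr_mul0l.
    by rewrite !gr_mulBl e e'.
  elim/freeg_ind: y => [|y y' e e'|j]; first by rewrite !(gr_mul0r, gr_mul0l).
    by rewrite !(gr_mulBl, gr_mulBr) e e'.
  elim/freeg_ind: z => [|z z' e e'|l]; first by rewrite !gr_mul0r.
    by rewrite !gr_mulBr e e'.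
  rewrite !gr_class_repr !gr_mul_class; apply: gr_class_iso.
  exact/isomorphic_sym/assoc_iso.
- move=> x; elim/freeg_ind: x => [|x x' e e'|i]; first by rewrite gr_mul0r.
    by rewrite gr_mulBr e e'.
  by rewrite gr_class_repr gr_mul_class; apply/gr_class_iso/lunit_iso.
- move=> x; elim/freeg_ind: x => [|x x' e e'|i]; first by rewrite gr_mul0l.
    by rewrite gr_mulBl e e'.
  by rewrite gr_class_repr gr_mul_class; apply/gr_class_iso/runit_iso.
- exact: gr_mulDl.
- by move=> z x y; apply: gr_mulDr.
Qed.

Lemma gr_class_eq0 X : gr_class X = 0 -> is_zero X.
Proof.
move=> X0; apply: contrapT => /split_simple[Y [S YSX]].
have := congr1 (coeff (cls S)) X0.
rewrite (gr_class_biprod YSX) gr_class_simple coeffD coeff_gr_class coeffU.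
rewrite coeff0.
by rewrite eqxx mulr1 natr1 => /eqP; rewrite pnatr_eq0.
Qed.

(** Split off a simple summand [S]: the class of [S] must already be the basis
    element, so the complement has class zero and vanishes. *)
Lemma gr_class_basis_simple X (i : simple_class C) :
  gr_class X = << i >> -> simple X.
Proof.
move=> Xi; have [|Y [S YSX]] := @split_simple X.
  move=> /gr_class_zero; rewrite Xi => /(congr1 (coeff i)).
  by rewrite coeffU coeff0 eqxx.
have e : gr_class Y + << cls S >> = << i >>.
  by rewrite -Xi (gr_class_biprod YSX) gr_class_simple.
have Si : cls S = i.
  have := congr1 (coeff (cls S)) e; rewrite coeffD !coeffU coeff_gr_class eqxx.
  rewrite mulr1 natr1 mul1r eq_sym; case: eqP => // _ /eqP.
  by rewrite pnatr_eq0.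
have Y0 : gr_class Y = 0 by apply: (addIr << i >>); rewrite add0r -{1}Si.
by apply: simple_iso (biprod_zerol YSX (gr_class_eq0 Y0)) _.
Qed.

Section SimpleUnit.
Hypotheses (rigC : rigid C) (simple1 : simple one).
Let u : simpleObj C := SimpleObj simple1.

(** For a left dual [Y] of [S], the spaces of endomorphisms of [Y] and of [S]
    are both isomorphic to the space of morphisms from the unit to [S \ox Y],
    so that [Y] is simple. *)
Lemma exists_dual (S : simpleObj C) : exists T : simpleObj C, is_left_dual S T.
Proof.
have [[Y SY] _] := rigC S.
have sY : simple Y.
  apply: simple_hdim1; have <- : hdim S S = 1%N by rewrite hdim_simpleE eqxx.
  rewrite -(hdim_iso (runit_iso Y) (isomorphic_refl Y)) (hdim_left_dual _ _ SY).
  rewrite -(hdim_right_dual _ _ SY).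
  by apply: hdim_iso (lunit_iso S) (isomorphic_refl S).
by exists (SimpleObj sY).
Qed.

(** The representative of the class of a dual is only isomorphic to the dual;
    the two adjunctions survive at the level of dimensions, which is all that is
    used about duals below. *)
Lemma exists_class_dual :
  exists star : simple_class C -> simple_class C, forall i,
  (forall V W, hdim (repr (star i) \ox W) V = hdim W (repr i \ox V)) /\
  (forall V W, hdim (W \ox repr i) V = hdim W (V \ox repr (star i))).
Proof.
have [dual dualP] := choice exists_dual.
exists (fun i => cls (dual (repr i))) => i; have e := repr_iso (dual (repr i)).
split=> V W.
  rewrite -(hdim_left_dual _ _ (dualP (repr i))).
  exact: hdim_iso (tens_iso e (isomorphic_refl _)) (isomorphic_refl _).
rewrite (hdim_right_dual _ _ (dualP (repr i))).
apply: hdim_iso (isomorphic_refl _) (tens_iso (isomorphic_refl _) _).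
exact: isomorphic_sym.
Qed.

(** The unit being simple, its class is the only basis element on which [tau] is
    not zero. *)
Lemma tau_coeff (x : {freeg simple_class C}) : @tau (Gr C) x = coeff (cls u) x.
Proof.
rewrite /tau [RHS]/coeff.
apply: (congr1 (fun f : simple_class C -> int^o => fglift f x)).
apply/funext => i /=.
rewrite (gr_class_simple u) coeffU mul1r (eq_sym i).
by case: (_ == i).
Qed.

(** The multiplicity of the unit in [b_i b_j] is computed by both adjunctions:
    one gives 1 exactly when [star i = j], the other exactly when [i = star j].
    Their agreement makes [star] an involution, and either of them is the
    condition on [tau]. *)
Lemma gr_is_based_ring : is_based_ring (Gr C).
Proof.
split; first exact: gr_is_Zplus_ring.
have [star starP] := exists_class_dual.
have tauE (i j : simple_class C) :
    @tau (Gr C) (@bd_mul (Gr C) (@bd_basis (Gr C) i) (@bd_basis (Gr C) j)) =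
    (hdim one (repr i \ox repr j))%:R.
  rewrite tau_coeff /= /bd_basis /gr_mul !fgliftU coeff_gr_class.
  congr (_%:R); apply: hdim_iso (repr_iso u) (isomorphic_refl _).
have tau_l (i j : simple_class C) :
    hdim one (repr i \ox repr j) = (star i == j).
  rewrite -(starP i).1 (hdim_iso (runit_iso _) (isomorphic_refl _)).
  by rewrite hdim_simpleE !reprK.
have tau_r (i j : simple_class C) :
    hdim one (repr i \ox repr j) = (i == star j).
  rewrite (hdim_simple_sym u) (starP j).2.
  rewrite (hdim_iso (isomorphic_refl _) (lunit_iso _)).
  by rewrite hdim_simpleE !reprK.
have starK : involutive star.
  move=> i; apply/esym/eqP; have := tau_r i (star i).
  by rewrite tau_l eqxx; case: eqP.
exists star; split=> //; last by move=> i j; rewrite tauE tau_r.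
pose starR : {freeg simple_class C} -> {freeg simple_class C} :=
  fglift (fun i => << star i >>).
have coeff_starR l x : coeff l (starR x) = coeff (star l) x.
  elim/freeg_ind: x => [|x y e e'|i]; first by rewrite /starR fglift0 !coeff0.
    by rewrite /starR fgliftB !coeffB e e'.
  by rewrite /starR fgliftU !coeffU -[in RHS](inj_eq (can_inj starK)) starK.
move=> x y; rewrite -/starR /=.
have starB a b : starR (a - b) = starR a - starR b by exact: fgliftB.
have star0 : starR 0 = 0 by exact: fglift0.
elim/freeg_ind: x => [|x x' e e'|i].
- by rewrite gr_mul0l star0 gr_mul0r.
- by rewrite gr_mulBl !starB e e' gr_mulBr.
elim/freeg_ind: y => [|y y' e e'|j].
- by rewrite gr_mul0r star0 gr_mul0l.
- by rewrite gr_mulBr !starB e e' gr_mulBl.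
(* Both coefficients equal the dimension of the space of morphisms from the
   tensor product of the objects of index l, i and j to the unit. *)
apply: freeg_coeff_eq => l; rewrite coeff_starR /starR !fgliftU.
rewrite /gr_mul !fgliftU !coeff_gr_class; congr (_%:R).
rewrite -(starP i).2.
rewrite -(hdim_iso (isomorphic_refl _) (lunit_iso (repr (star j)))).
rewrite -(starP j).2 (hdim_iso (assoc_iso _ _ _) (isomorphic_refl _)).
rewrite -[in RHS](starK l) (starP (star l)).1.
by rewrite (hdim_iso (isomorphic_refl _) (runit_iso _)) hdim_simple_sym.
Qed.

(** The given list of objects may contain objects that are not simple, for which
    the class attached to them below is a default value. *)
Lemma gr_is_fusion_ring : finitely_many_simples C -> is_fusion_ring (Gr C).
Proof.
move=> [n [S Sall]]; split; first exact: gr_is_based_ring.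
  by exists (cls u); apply: (gr_class_simple u).
pose c j := xget (cls u)
  [set i : simple_class C | isomorphic (repr i) (S j)]%classic.
exists [seq c j | j <- enum 'I_n] => i.
have [j ij] := Sall _ (simpleP (repr i)).
apply/mapP; exists j; rewrite ?mem_enum // /c.
case: xgetP => [i' _ /= i'j|/(_ i)//].
apply/eqP; rewrite -[i]reprK -[i']reprK simple_class_eq; apply/asboolP.
exact: isomorphic_trans ij (isomorphic_sym i'j).
Qed.

End SimpleUnit.

Lemma simple_unit_separable (A : algebra C) :
  simple one -> ~ is_zero (alg_ob A) -> separable (free_functor A).
Proof.
move=> s1 A0; have [c cu] := simple_retract abelC ssC s1 (alg_unit_neq0 A0).
exact: unit_retract_separable cu.
Qed.

Lemma separable_unit_simple : ~ is_zero one ->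
  (forall A : algebra C, ~ is_zero (alg_ob A) -> separable (free_functor A)) ->
  simple one.
Proof.
move=> one0 sep; have [Y [S YSone]] := split_simple one0.
apply: (simple_iso _ (simpleP S)); apply: (biprod_zerol YSone).
have [i [p [j [q [pi qj pj qi ipjq]]]]] := YSone.
(* The idempotent onto Y vanishes after tensoring with the algebra S. *)
have e0 : i \o p = 0.
  apply: (separable_faithful (sep (retract_algebra qj) (simpleP S).1)).
  apply: rmod_map_inj => /=; rewrite tensm0l.
  by apply: (retract_tens_eq0 qj); rewrite -compA pj compf0.
have idY : p \o (i \o p) \o i = idm Y by rewrite !compA pi comp1f pi.
by apply/is_zeroP; rewrite -idY e0 compf0 comp0f.
Qed.

End Multifusion.

Theorem proposition6p9 (k : closedFieldType) (C : monCategory k)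
    (multifusion_C : multifusion C) (C_neq0 : ~ is_zero (unit_ob C)) :
  is_fusion_ring (Gr C) <->
  (forall A : algebra C, ~ is_zero (alg_ob A) -> separable (free_functor A)).
Proof.
case: multifusion_C => [[abelC lfC rigC] [finC _] ssC].
split=> [[_ unital _] A|sep].
  apply: simple_unit_separable => //.
  by case: unital => i /= /gr_class_basis_simple; apply.
by apply: gr_is_fusion_ring => //; apply: separable_unit_simple.
Qed.
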